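(* Let $p$ be an odd prime. Then $$n(p^9,2)=1+2X_{3,5}(p)+X_{9,17}(p)+X_{128,257}(p)+X_{2,3}(p)\cdot\bigl(3+X_{2,11}(p)+X_{8,43}(p)\bigr).$$
   Context: $\mathbb{N}=\{0,1,2,\dots\}$. A numerical semigroup is a subset $S\subset\mathbb{N}$ containing $0$, stable under addition and with finite complement in $\mathbb{N}$; its genus is $|\mathbb{N}\setminus S|$. For $g\ge 1$, $n(g,2)$ denotes the number of numerical semigroups $S$ of genus $g$ of the form $S=\langle a,b\rangle=\mathbb{N}a+\mathbb{N}b$ (two generators); semigroups are counted as sets. For an integer $a$ and a prime $q$, the function $X_{a,q}:\mathbb{Z}\to\{0,1\}$ is defined by $X_{a,q}(n)=1$ if $n\not\equiv a \pmod q$ and $X_{a,q}(n)=0$ if $n\equiv a\pmod q$. *)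

(* Defs.v *)
From mathcomp Require Import all_boot all_order all_algebra.
From mathcomp Require Import finmap.
From mathcomp Require Import boolp classical_sets cardinality.

Set Implicit Arguments.
Unset Strict Implicit.
Unset Printing Implicit Defensive.

Local Open Scope classical_set_scope.

Definition numerical_semigroup (S : set nat) : Prop :=
  [/\ S 0, (forall m n, S m -> S n -> S (m + n)) & finite_set (~` S)].

(* [fset_set] sends an infinite set to the empty [fset], so this value is
   meaningful only when the complement of [S] is finite. *)
Definition genus (S : set nat) : nat := #|` fset_set (~` S) |.

Definition gen2 (a b : nat) : set nat :=
  [set n | exists x y, n = x * a + y * b].

Definition semigroups2 (g : nat) : set (set nat) :=
  [set S | [/\ numerical_semigroup S, genus S = g & exists a b, S = gen2 a b]].

(* [semigroups2 g] is finite for every [g >= 1]; were it infinite, [fset_set]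
   would make this count 0. *)
Definition n2 (g : nat) : nat := #|` fset_set (semigroups2 g) |.

Definition X (a : int) (q : nat) (n : int) : nat :=
  if (n == a %[mod q])%Z then 0 else 1.

(* Main.v *)
Require Import Defs.
From mathcomp Require Import all_boot all_order all_algebra.
From mathcomp Require Import finmap boolp classical_sets cardinality ring zify.
Set Implicit Arguments.
Unset Strict Implicit.
Unset Printing Implicit Defensive.

Import GRing.Theory.

(** Two facts reduce the count to elementary arithmetic.

    By Sylvester's theorem (genus_gen2), coprime a and b generate a semigroup
    of genus (a - 1)(b - 1)/2.  The semigroup determines its pair of minimal
    generators (gen2_generator), so n(g, 2) counts the unordered factorizations
    2g = xy with x + 1 and y + 1 coprime.  When g is odd exactly one of x, y is
    odd, and that factor is a divisor of g: this turns unordered factorizations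
    into divisors of g (n2_odd).  For g = p^9 the divisors are the p^i with
    0 <= i <= 9, and the i-th one counts if and only if p^i + 1 and
    2 p^(9-i) + 1 are coprime.

    A prime q divides both of these numbers exactly when x = p is a common root
    of x^i + 1 and 2 x^(9-i) + 1 in the field with q elements.  Eliminating x
    shows that such a root exists only if q divides an explicit integer N, and
    that the root is then the residue of an explicit integer a:
<<
      i   1   2   3   4   5   6   7    8    9
      N   3   5   3  17  33   5  129  257   3
      a   2   3   2   9   2   3   8   128   2
>>
    (for i = 0 the two numbers are always coprime, the first one being 2).
    Since 33 = 3 * 11 and 129 = 3 * 43, with 8 = 2 modulo 3, each i contributes
    a product of indicators X(a, q) over the primes q dividing N.  The sum of
    these products is the formula. *)

(** * Semigroups with two generators *)

Lemma gen2C a b : gen2 a b = gen2 b a.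
Proof.
by rewrite predeqE => n; split=> -[x [y ->]]; exists y, x; rewrite addnC.
Qed.

Lemma gen2D a b m n : gen2 a b m -> gen2 a b n -> gen2 a b (m + n).
Proof. by move=> [x [y ->]] [z [t ->]]; exists (x + z), (y + t); lia. Qed.

(** Write n = x a modulo b with 0 <= x < b.  If x a <= n then n is in the
    semigroup; otherwise x a - n is a positive multiple of b, which writes the
    reflection a b - a - b - n of n about half the Frobenius number as a
    combination of a and b. *)
Lemma gen2_or_dual a b n : 0 < a -> 0 < b -> coprime a b ->
  gen2 a b n \/ exists2 m, gen2 a b m & n + m + a + b = a * b.
Proof.
move=> a0 b0 ab.
have [x xb xan] : exists2 x, x < b & x * a = n %[mod b].
  have /dvdnP[k kE] : a %| chinese a b 0 n by rewrite /dvdn chinese_modl ?mod0n.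
  by exists (k %% b); rewrite ?ltn_mod// modnMml -kE chinese_modr.
have [le_xa|lt_n] := leqP (x * a) n.
  left; move/eqP: xan; rewrite eq_sym eqn_mod_dvd// => /dvdnP[y yE].
  by exists x, y; rewrite -yE subnKC.
right; move/eqP: xan; rewrite eqn_mod_dvd 1?ltnW// => /dvdnP[[|k] kE]; first lia.
exists ((b - x.+1) * a + k * b); first by exists (b - x.+1), k.
have : (b - x.+1) * a + x.+1 * a = b * a by rewrite -mulnDl subnK.
by lia.
Qed.

(** If both a number and its reflection were in the semigroup, a b would be
    x a + y b with x, y > 0; coprimality then forces b to divide x, so that
    x a + y b > a b. *)
Lemma gen2_dual_disjoint a b m n : 0 < a -> 0 < b -> coprime a b ->
  gen2 a b m -> gen2 a b n -> m + n + a + b <> a * b.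
Proof.
move=> a0 b0 ab gm gn.
have [x [y ->]] := gen2D gm gn => E.
have E' : x.+1 * a + y.+1 * b = a * b by lia.
have /dvdnP[k kE] : b %| x.+1.
  rewrite -(@Gauss_dvdl b x.+1 a) 1?coprime_sym//.
  by rewrite -(@dvdn_addl (y.+1 * b)) ?dvdn_mull// E' dvdn_mull.
have : 0 < k by lia.
by nia.
Qed.

Definition gaps a b : seq nat :=
  [seq n <- iota 0 (a.-1 * b.-1) | ~~ `[< gen2 a b n >]].

Lemma setC_gen2 a b : 0 < a -> 0 < b -> coprime a b ->
  (~` gen2 a b)%classic = [set` [fset n in gaps a b]%fset]%classic.
Proof.
move=> a0 b0 ab; rewrite predeqE => n /=; rewrite inE /= mem_filter mem_iota /=.
split=> [gn|/andP[/asboolPn]//]; apply/andP; split; first exact/asboolPn.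
by have [//|[m _ E]] := gen2_or_dual n a0 b0 ab; nia.
Qed.

(** The reflection n |-> a b - a - b - n exchanges the gaps and the non-gaps
    among the first (a - 1)(b - 1) numbers, so that half of them are gaps. *)
Lemma size_gaps a b : 0 < a -> 0 < b -> coprime a b ->
  2 * size (gaps a b) = a.-1 * b.-1.
Proof.
move=> a0 b0 ab; rewrite size_filter; set M := a.-1 * b.-1.
pose P n := `[< gen2 a b n >].
suff E : count (predC P) (iota 0 M) = count P (iota 0 M).
  by rewrite mul2n -addnn {1}E count_predC size_iota.
have -> : count P (iota 0 M) = count P [seq M.-1 - n | n <- iota 0 M].
  rewrite -count_rev; congr count; apply: (@eq_from_nth _ 0).
    by rewrite size_rev size_map.
  rewrite size_rev size_iota => i iM.
  by rewrite nth_rev ?size_iota// (nth_map 0) ?size_iota// !nth_iota//; lia.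
rewrite count_map; apply: eq_in_count => n; rewrite mem_iota /= => nM.
have ME : M.-1 + a + b = a * b by rewrite /M in nM *; nia.
rewrite /P; apply/idP/idP => /asboolP.
  move=> gn; apply/asboolP; have [//|[m gm E]] := gen2_or_dual n a0 b0 ab.
  by have -> : M.-1 - n = m by lia.
by move=> gn; apply/asboolP => gm; apply: (gen2_dual_disjoint a0 b0 ab gm gn); lia.
Qed.

Lemma numerical_gen2 a b : 0 < a -> 0 < b -> coprime a b ->
  numerical_semigroup (gen2 a b).
Proof.
move=> a0 b0 ab; split; [by exists 0, 0|by move=> m n; apply: gen2D|].
by rewrite setC_gen2//; exact: finite_fset.
Qed.

Lemma genus_gen2 a b : 0 < a -> 0 < b -> coprime a b ->
  2 * genus (gen2 a b) = a.-1 * b.-1.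
Proof.
move=> a0 b0 ab; rewrite -size_gaps// /genus setC_gen2// set_fsetK card_fseq.
by rewrite undup_id// filter_uniq// iota_uniq.
Qed.

(** Two consecutive large numbers both lie in the semigroup, and
    the gcd of the generators divides them. *)
Lemma numerical_gen2_coprime a b : numerical_semigroup (gen2 a b) -> coprime a b.
Proof.
case=> _ _ /finite_fsetP[F FE].
pose M := \max_(x <- F) x.
have big n : M < n -> gcdn a b %| n.
  move=> Mn; suff [x [y ->]] : gen2 a b n.
    by rewrite dvdn_add// dvdn_mull// ?dvdn_gcdl ?dvdn_gcdr.
  apply: contrapT => nS; have : [set` F]%classic n by rewrite -FE.
  by move=> /= nF; have := leq_bigmax_seq (F := id) n nF isT; rewrite -/M; lia.
have d1 := big M.+1 (leqnn _); have := big M.+2 (leqW (leqnn _)).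
by rewrite -(addn1 M.+1) (dvdn_addr _ d1) dvdn1.
Qed.

Lemma gen2_1 b : gen2 1 b = setT.
Proof. by rewrite predeqE => n; split=> // _; exists n, 0; lia. Qed.

Lemma gen2_nontrivial a b : numerical_semigroup (gen2 a b) ->
  0 < genus (gen2 a b) -> 1 < a /\ 1 < b.
Proof.
have genusT : genus setT = 0 by rewrite /genus setCT fset_set0.
wlog ab : a b / a <= b.
  move=> H; case: (leqP a b) => [|/ltnW] ab; first exact: H.
  by rewrite gen2C => nS /(H _ _ ab nS) [].
move=> /numerical_gen2_coprime co; case: a => [|[|a]] in ab co *; last by lia.
  by move: co; rewrite /coprime gcd0n => /eqP ->; rewrite gen2C gen2_1 genusT.
by rewrite gen2_1 genusT.
Qed.

(** * Counting through factorizations of 2g *)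

(** A nonzero summand other than a cannot involve a, for lack of room; if both
    summands were of this kind, b would divide a. *)
Lemma gen2_irred a b s t : 1 < a -> 1 < b -> coprime a b ->
  gen2 a b s -> gen2 a b t -> s + t = a -> s = 0 \/ t = 0.
Proof.
move=> a1 b1 ab [x [y sE]] [z [w tE]] E.
have [x0|x0] := posnP x; last by nia.
have [z0|z0] := posnP z; last by nia.
have : b %| gcdn a b by rewrite dvdn_gcd dvdnn andbT -E sE tE x0 z0 -mulnDl dvdn_mull.
by rewrite (eqP ab) dvdn1; lia.
Qed.

(** The generator a is irreducible in its semigroup, whereas the irreducible
    elements generated by c and e are among c and e. *)
Lemma gen2_generator a b c e : 1 < a -> 1 < b -> coprime a b -> 0 < c -> 0 < e ->
  gen2 a b = gen2 c e -> a = c \/ a = e.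
Proof.
move=> a1 b1 ab c0 e0 S.
have ga : gen2 c e a by rewrite -S; exists 1, 0; lia.
have gc : gen2 a b c by rewrite S; exists 1, 0; lia.
have ge : gen2 a b e by rewrite S; exists 0, 1; lia.
case: ga => -[|x] [y aE].
  case: y aE => [|y] aE; first by lia.
  have gr : gen2 a b (y * e) by rewrite S; exists 0, y.
  by right; have [] := gen2_irred a1 b1 ab ge gr; lia.
have gr : gen2 a b (x * c + y * e) by rewrite S; exists x, y.
by left; have [] := gen2_irred a1 b1 ab gc gr; lia.
Qed.

(** The divisor d of the odd number g stands for the factorization
    2 g = d (2 g / d), of which d is the odd factor. *)
Lemma n2_odd g : odd g ->
  n2 g = count (fun d => coprime d.+1 (2 * g %/ d).+1) (divisors g).
Proof.
move=> og; have g0 : 0 < g by case: g og.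
pose e d := 2 * g %/ d.
pose P d := coprime d.+1 (e d).+1.
pose f d := gen2 d.+1 (e d).+1.
have eP d : d %| g -> d * e d = 2 * g by move=> dg; rewrite mulnC divnK// dvdn_mull.
have SE : semigroups2 g =
    [set` [fset f d | d in [fset d in filter P (divisors g)]]%fset]%classic.
  rewrite predeqE => S; split=> [[nS gS [a [b SE]]]|/imfsetP[d]].
    have [x [y [xodd xy -> co]]] : exists x y,
        [/\ odd x, x * y = 2 * g, S = gen2 x.+1 y.+1 & coprime x.+1 y.+1].
      subst S; have co := numerical_gen2_coprime nS.
      have [a1 b1] : 1 < a /\ 1 < b by apply: gen2_nontrivial; rewrite ?gS.
      have xy : a.-1 * b.-1 = 2 * g by rewrite -gS genus_gen2 ?(ltnW a1) ?(ltnW b1).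
      case oa: (odd a.-1); [exists a.-1, b.-1 | exists b.-1, a.-1].
        by rewrite !prednK ?(ltnW a1) ?(ltnW b1).
      rewrite !prednK ?(ltnW a1) ?(ltnW b1)//.
      split; [|by rewrite mulnC|exact: gen2C|by rewrite coprime_sym].
      have a2 : a.-1 = (a.-1)./2.*2 by rewrite -[LHS]odd_double_half oa.
      have ogE : g = (a.-1)./2 * b.-1 by lia.
      by move: og; rewrite ogE oddM => /andP[].
    have xg : x %| g by rewrite -(@Gauss_dvdr x 2) ?coprimen2// -xy dvdn_mulr.
    have yE : y = e x by rewrite /e -xy mulKn//; case: (x) xodd.
    apply/imfsetP; exists x => /=.
      by rewrite inE /= mem_filter -dvdn_divisors// xg /P -yE co.
    by rewrite /f -yE.
  rewrite /= inE /= mem_filter -dvdn_divisors// => /andP[co dg] ->.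
  split; [exact: numerical_gen2| |by exists d.+1, (e d).+1].
  by apply/eqP; rewrite -(eqn_pmul2l (m := 2))// genus_gen2//= eP.
rewrite /n2 SE set_fsetK card_in_imfset /=.
  by rewrite card_fseq undup_id ?filter_uniq ?divisors_uniq// size_filter.
move=> c d; rewrite !inE /= !mem_filter -!dvdn_divisors// => /andP[coc cg] /andP[cod dg] E.
have d_gt0 := dvdn_gt0 g0 dg; have c_gt0 := dvdn_gt0 g0 cg.
have eP0 k : k %| g -> 0 < e k.
  by move=> kg; have := eP k kg; case: (e k) => //; lia.
(* Equality with the other generator contradicts the parity of the factors. *)
have [] := gen2_generator _ _ coc _ _ E; rewrite ?ltnS ?eP0//; first by case.
have odd_d k : k %| g -> odd k.
  by move=> /dvdnP[l gE]; move: og; rewrite gE oddM => /andP[].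
have := congr1 odd (eP d dg); rewrite !oddM (odd_d d dg) /= => ed [cE].
by have := odd_d c cg; rewrite cE ed.
Qed.

(** * Common roots of x^i + 1 and 2 x^j + 1, where i + j = 9 *)

Section Resonances.
Local Open Scope ring_scope.

Lemma eq0_comb (R : comPzRingType) (a b c u v : R) :
  a = 0 -> b = 0 -> c = u * a + v * b -> c = 0.
Proof. by move=> -> -> ->; rewrite !mulr0 addr0. Qed.

(** The lemmas of this section eliminate x between x^i + 1 and 2 x^j + 1; the
    coefficients u and v witness memberships in the ideals generated by these
    two polynomials and by N and x - a. *)
Section CommonRoots.
Variables (R : idomainType) (x : R).

Lemma common_root1 : (x ^+ 1 + 1 = 0 /\ 2 * x ^+ 8 + 1 = 0) <->
  (3 = 0 :> R /\ x - 2 = 0).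
Proof.
pose Q := (x - 1) * (x ^+ 2 + 1) * (x ^+ 4 + 1).
split=> -[h1 h2].
  have N : 3 = 0 :> R.
    by apply: (eq0_comb (u := - 2 * Q) (v := 1) h1 h2); rewrite /Q; ring.
  by split=> //; apply: (eq0_comb (u := 1) (v := -1) h1 N); ring.
have A : x ^+ 1 + 1 = 0 by apply: (eq0_comb (u := 1) (v := 1) h1 h2); ring.
by split=> //; apply: (eq0_comb (u := 2 * Q) (v := 1) A h1); rewrite /Q; ring.
Qed.

(** Here x^7 reduces to - x modulo x^2 + 1, which leaves the linear equation
    L : 1 - 2 x = 0. *)
Lemma common_root2 : (x ^+ 2 + 1 = 0 /\ 2 * x ^+ 7 + 1 = 0) <->
  (5 = 0 :> R /\ x - 3 = 0).
Proof.
pose Q := 2 * x * (x ^+ 4 - x ^+ 2 + 1).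
split=> -[h1 h2].
  have L : 1 - 2 * x = 0 by apply: (eq0_comb (u := - Q) (v := 1) h1 h2); rewrite /Q; ring.
  have N : 5 = 0 :> R by apply: (eq0_comb (u := 4) (v := 2 * x + 1) h1 L); ring.
  by split=> //; apply: (eq0_comb (u := - 3) (v := - x) L N); ring.
have A : x ^+ 2 + 1 = 0 by apply: (eq0_comb (u := 2) (v := x + 3) h1 h2); ring.
have L : 1 - 2 * x = 0 by apply: (eq0_comb (u := - 1) (v := - 2) h1 h2); ring.
by split=> //; apply: (eq0_comb (u := Q) (v := 1) A L); rewrite /Q; ring.
Qed.

(** In characteristic 3 the polynomial x^3 + 1 is (x + 1)^3. *)
Lemma common_root3 : (x ^+ 3 + 1 = 0 /\ 2 * x ^+ 6 + 1 = 0) <->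
  (3 = 0 :> R /\ x - 2 = 0).
Proof.
split=> -[h1 h2].
  have N : 3 = 0 :> R by apply: (eq0_comb (u := - 2 * (x ^+ 3 - 1)) (v := 1) h1 h2); ring.
  have P : (x + 1) ^+ 3 = 0 by apply: (eq0_comb (u := 1) (v := x ^+ 2 + x) h1 N); ring.
  move/eqP: P; rewrite expf_eq0 => /eqP P.
  by split=> //; apply: (eq0_comb (u := 1) (v := - 1) P N); ring.
have A : x ^+ 3 + 1 = 0 by apply: (eq0_comb (u := 3) (v := x ^+ 2 + 2 * x + 4) h1 h2); ring.
by split=> //; apply: (eq0_comb (u := 2 * (x ^+ 3 - 1)) (v := 1) A h1); ring.
Qed.

Lemma common_root4 : (x ^+ 4 + 1 = 0 /\ 2 * x ^+ 5 + 1 = 0) <->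
  (17 = 0 :> R /\ x - 9 = 0).
Proof.
pose Q := (2 * x + 1) * (4 * x ^+ 2 + 1).
split=> -[h1 h2].
  have L : 1 - 2 * x = 0 by apply: (eq0_comb (u := - (2 * x)) (v := 1) h1 h2); ring.
  have N : 17 = 0 :> R by apply: (eq0_comb (u := 16) (v := Q) h1 L); rewrite /Q; ring.
  by split=> //; apply: (eq0_comb (u := - 9) (v := - x) L N); ring.
have L : 1 - 2 * x = 0 by apply: (eq0_comb (u := - 1) (v := - 2) h1 h2); ring.
have A : x ^+ 4 + 1 = 0 by apply: (eq0_comb (u := x ^+ 4) (v := Q) h1 L); rewrite /Q; ring.
by split=> //; apply: (eq0_comb (u := 2 * x) (v := 1) A L); ring.
Qed.

Lemma common_root5 : (x ^+ 5 + 1 = 0 /\ 2 * x ^+ 4 + 1 = 0) <->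
  (33 = 0 :> R /\ x - 2 = 0).
Proof.
pose Q := x ^+ 4 + 2 * x ^+ 3 + 4 * x ^+ 2 + 8 * x + 16.
split=> -[h1 h2].
  have L : x - 2 = 0 by apply: (eq0_comb (u := - 2) (v := x) h1 h2); ring.
  by split=> //; apply: (eq0_comb (u := 1) (v := - Q) h1 L); rewrite /Q; ring.
split; first by apply: (eq0_comb (u := 1) (v := Q) h1 h2); rewrite /Q; ring.
by apply: (eq0_comb (u := 1) (v := 2 * (x + 2) * (x ^+ 2 + 4)) h1 h2); ring.
Qed.

(** Here N = 5 and x^3 = 2; as 2 has cube roots other than 3 in the field with
    25 elements, x must be known to lie in the prime field. *)
Lemma common_root6 : x ^+ 5 = x \/ 5 <> 0 :> R ->
  (x ^+ 6 + 1 = 0 /\ 2 * x ^+ 3 + 1 = 0) <-> (5 = 0 :> R /\ x - 3 = 0).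
Proof.
move=> F; split=> -[h1 h2].
  have N : 5 = 0 :> R by apply: (eq0_comb (u := 4) (v := 1 - 2 * x ^+ 3) h1 h2); ring.
  case: F => // F; have A : x ^+ 2 + 1 = 0 by rewrite -[RHS]h1 [x ^+ 6]exprS F; ring.
  have L : x + 2 = 0.
    have C : x ^+ 3 - 2 = 0 by apply: (eq0_comb (u := 3) (v := - (x ^+ 3 + 1)) h2 N); ring.
    by apply: (eq0_comb (u := x) (v := - 1) A C); ring.
  by split=> //; apply: (eq0_comb (u := 1) (v := - 1) L N); ring.
pose Q := x ^+ 2 + 3 * x + 9.
split; last by apply: (eq0_comb (u := 11) (v := 2 * Q) h1 h2); rewrite /Q; ring.
by apply: (eq0_comb (u := 146) (v := Q * (x ^+ 3 + 27)) h1 h2); rewrite /Q; ring.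
Qed.

(** From 2 x^2 = -1 follows 8 x^6 = -1, and x^7 = -1 then gives x = 8. *)
Lemma common_root7 : (x ^+ 7 + 1 = 0 /\ 2 * x ^+ 2 + 1 = 0) <->
  (129 = 0 :> R /\ x - 8 = 0).
Proof.
pose Q := x * (4 * x ^+ 4 - 2 * x ^+ 2 + 1).
split=> -[h1 h2].
  have L : x - 8 = 0 by apply: (eq0_comb (u := - 8) (v := Q) h1 h2); rewrite /Q; ring.
  by split=> //; apply: (eq0_comb (u := 1) (v := - 2 * (x + 8)) h2 L); ring.
have B : 2 * x ^+ 2 + 1 = 0 by apply: (eq0_comb (u := 1) (v := 2 * (x + 8)) h1 h2); ring.
have A : 8 * (x ^+ 7 + 1) = 0 by apply: (eq0_comb (u := Q) (v := - 1) B h2); rewrite /Q; ring.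
(* Modulo 129 the inverse of 8 is -16. *)
by split=> //; apply: (eq0_comb (u := x ^+ 7 + 1) (v := - 16) h1 A); ring.
Qed.

Lemma common_root8 : (x ^+ 8 + 1 = 0 /\ 2 * x ^+ 1 + 1 = 0) <->
  (257 = 0 :> R /\ x - 128 = 0).
Proof.
pose Q := (2 * x - 1) * (4 * x ^+ 2 + 1) * (16 * x ^+ 4 + 1).
split=> -[h1 h2].
  have N : 257 = 0 :> R by apply: (eq0_comb (u := 256) (v := - Q) h1 h2); rewrite /Q; ring.
  by split=> //; apply: (eq0_comb (u := - 128) (v := x) h2 N); ring.
have B : 2 * x ^+ 1 + 1 = 0 by apply: (eq0_comb (u := 1) (v := 2) h1 h2); ring.
by split=> //; apply: (eq0_comb (u := x ^+ 8) (v := - Q) h1 B); rewrite /Q; ring.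
Qed.

(** In characteristic 3 the polynomial x^9 + 1 is (x + 1)^9. *)
Lemma common_root9 : (x ^+ 9 + 1 = 0 /\ 2 * x ^+ 0 + 1 = 0) <->
  (3 = 0 :> R /\ x - 2 = 0).
Proof.
split=> -[h1 h2].
  have N : 3 = 0 :> R by rewrite -[RHS]h2; ring.
  have P : (x + 1) ^+ 9 = 0.
    apply: (eq0_comb (u := 1) (v := 3 * x + 12 * x ^+ 2 + 28 * x ^+ 3 + 42 * x ^+ 4
      + 42 * x ^+ 5 + 28 * x ^+ 6 + 12 * x ^+ 7 + 3 * x ^+ 8) h1 N); ring.
  move/eqP: P; rewrite expf_eq0 => /eqP P.
  by split=> //; apply: (eq0_comb (u := 1) (v := - 1) P N); ring.
have P : x + 1 = 0 by apply: (eq0_comb (u := 1) (v := 1) h1 h2); ring.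
have D : x ^+ 9 + 1 = (x + 1) * (x ^+ 2 - x + 1) * (x ^+ 6 - x ^+ 3 + 1) by ring.
by split; [rewrite D P !mul0r | rewrite -[RHS]h1; ring].
Qed.
End CommonRoots.

(** Two numbers are coprime unless some prime q divides both; reading this
    divisibility in the field with q elements, where the common root is
    described by N and a, leaves only the primes dividing N to be tested. *)
Lemma coprime_resonance p i j a N : (0 < N)%N ->
  (forall q, prime q -> let x : 'F_q := p%:R in
    (x ^+ i + 1 = 0 /\ 2 * x ^+ j + 1 = 0) <-> (N%:R = 0 :> 'F_q /\ x - a%:R = 0)) ->
  coprime (p ^ i).+1 (2 * p ^ j)%N.+1 =
  all (fun q => ~~ (p == a %[mod q])%N) (primes N).
Proof.
move=> N0 H; have HE q : prime q ->
    (q %| (p ^ i).+1)%N && (q %| (2 * p ^ j).+1)%N = (q %| N)%N && (p == a %[mod q])%N.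
  move=> pq; rewrite !(dvdn_pcharf (pchar_Fp pq)).
  rewrite -(@natr1 _ (p ^ i)%N) -(@natr1 _ (2 * p ^ j)%N) natrM !natrX.
  have -> : (p == a %[mod q])%N = (p%:R - a%:R == 0 :> 'F_q).
    rewrite subr_eq0; apply/eqP/eqP=> [E|/(congr1 (fun z : 'F_q => z : nat))].
      by rewrite -(Fp_nat_mod pq p) E Fp_nat_mod.
    by rewrite !val_Fp_nat.
  by apply/andP/andP=> -[/eqP u /eqP v]; have [h1 h2] := H q pq;
    [have [] := h1 (conj u v) | have [] := h2 (conj u v)] => -> ->.
apply/idP/allP => [co q|co].
  rewrite mem_primes => /and3P[pq _ qN]; apply/negP => pa.
  have := HE q pq; rewrite qN pa => /andP[qa qb].
  have : (q %| gcdn (p ^ i).+1 (2 * p ^ j).+1)%N by rewrite dvdn_gcd qa.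
  by rewrite (eqP co) dvdn1 => /eqP q1; rewrite q1 in pq.
rewrite /coprime; apply: contraT => g1.
have pq := pdiv_prime (n := gcdn (p ^ i).+1 (2 * p ^ j).+1).
move: (pdiv_dvd (gcdn (p ^ i).+1 (2 * p ^ j).+1)) pq.
rewrite ltn_neqAle eq_sym g1 gcdn_gt0 /=; set q := pdiv _ => qg /(_ isT) pq.
have := HE q pq; rewrite -dvdn_gcd qg => /esym /andP[qN pa].
by have := co q; rewrite mem_primes pq N0 qN pa; apply.
Qed.
End Resonances.

(** * The genus p^9 *)

Lemma X_nat (a p q : nat) : X a q p = ~~ (p == a %[mod q]).
Proof. by rewrite /X !modz_nat eqz_nat; case: eqP. Qed.

Lemma divisors_pfactor p n : prime p ->
  perm_eq (divisors (p ^ n)) [seq p ^ i | i <- iota 0 n.+1].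
Proof.
move=> pp; apply: uniq_perm; first exact: divisors_uniq.
  by rewrite map_inj_uniq ?iota_uniq//; exact: expnI (prime_gt1 pp).
move=> d; rewrite -dvdn_divisors ?expn_gt0 ?prime_gt0//.
apply/(dvdn_pfactor _ _ pp)/mapP => -[i iE ->]; exists i => //.
  by rewrite mem_iota.
by move: iE; rewrite mem_iota.
Qed.

Theorem theorem6p1 (p : nat) (hp : prime p) (hodd : odd p) :
  n2 (p ^ 9) =
    1 + 2 * X 3 5 p + X 9 17 p + X 128 257 p
      + X 2 3 p * (3 + X 2 11 p + X 8 43 p).
Proof.
have p0 := prime_gt0 hp.
rewrite n2_odd ?oddX ?hodd// (permP (divisors_pfactor 9 hp)) count_map.
pose c i := coprime (p ^ i).+1 (2 * p ^ (9 - i)).+1.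
have -> : count (preim (expn p) (fun d => coprime d.+1 (2 * p ^ 9 %/ d).+1)) (iota 0 10)
    = count c (iota 0 10).
  apply: eq_in_count => i; rewrite mem_iota => /= i9.
  by rewrite /= /c expnB// muln_divA// dvdn_exp2l.
have c0 : c 0 by rewrite /c expn0 coprime2n /= oddM.
have c1 : c 1 = all (fun q => ~~ (p == 2 %[mod q])) (primes 3).
  by apply: coprime_resonance => // q pq x; exact: common_root1.
have c2 : c 2 = all (fun q => ~~ (p == 3 %[mod q])) (primes 5).
  by apply: coprime_resonance => // q pq x; exact: common_root2.
have c3 : c 3 = all (fun q => ~~ (p == 2 %[mod q])) (primes 3).
  by apply: coprime_resonance => // q pq x; exact: common_root3.
have c4 : c 4 = all (fun q => ~~ (p == 9 %[mod q])) (primes 17).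
  by apply: coprime_resonance => // q pq x; exact: common_root4.
have c5 : c 5 = all (fun q => ~~ (p == 2 %[mod q])) (primes 33).
  by apply: coprime_resonance => // q pq x; exact: common_root5.
have c6 : c 6 = all (fun q => ~~ (p == 3 %[mod q])) (primes 5).
  apply: coprime_resonance => // q pq x; apply: common_root6.
  (* The only field of characteristic 5 that occurs is the prime one, where
     Fermat's little theorem gives x^5 = x. *)
  have [x5|x5] := eqVneq (5%:R : 'F_q)%R 0%R; [left|by right; exact/eqP].
  move/eqP: x5; rewrite -(dvdn_pcharf (pchar_Fp pq)) dvdn_prime2// => /eqP q5.
  by subst q; rewrite /x -natrX -(Fp_nat_mod pq (p ^ 5)) fermat_little// Fp_nat_mod.
have c7 : c 7 = all (fun q => ~~ (p == 8 %[mod q])) (primes 129).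
  by apply: coprime_resonance => // q pq x; exact: common_root7.
have c8 : c 8 = all (fun q => ~~ (p == 128 %[mod q])) (primes 257).
  by apply: coprime_resonance => // q pq x; exact: common_root8.
have c9 : c 9 = all (fun q => ~~ (p == 2 %[mod q])) (primes 3).
  by apply: coprime_resonance; [|move=> q pq x; exact: common_root9].
have -> : iota 0 10 = [:: 0; 1; 2; 3; 4; 5; 6; 7; 8; 9] by [].
rewrite [LHS]/count c0 c1 c2 c3 c4 c5 c6 c7 c8 c9 !X_nat.
have -> : primes 3 = [:: 3] by [].
have -> : primes 5 = [:: 5] by [].
have -> : primes 17 = [:: 17] by [].
have -> : primes 33 = [:: 3; 11] by [].
have -> : primes 129 = [:: 3; 43] by [].
have -> : primes 257 = [:: 257] by [].
rewrite /all !andbT.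
have -> : (p == 8 %[mod 3]) = (p == 2 %[mod 3]) by [].
(* Both sides are now polynomials in six booleans. *)
by do 6 case: (_ == _ %[mod _]).
Qed.
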